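(* For every integer $n\geq 1$, $\mathrm{ex}_{\mathcal{P}}(n,S_{2,5})\leq \frac{19}{7}n-\frac{18}{7}$, and equality holds when $n=12$.
   Context: All graphs are simple and finite. The double star $S_{2,5}$ is the graph (a tree on 9 vertices) obtained from an edge $uv$ by joining $u$ to 2 new vertices and $v$ to 5 further new vertices, all 7 new vertices being distinct. A graph is $H$-free if it does not contain $H$ as a (not necessarily induced) subgraph. The planar Turán number $\mathrm{ex}_{\mathcal{P}}(n,H)$ is the maximum number of edges in an $H$-free planar graph on $n$ vertices. *)

(* Defs.v *)
From HB Require Import structures.
From mathcomp Require Import all_boot all_order all_algebra.
From mathcomp Require Import all_classical all_reals all_analysis.

Set Implicit Arguments.
Unset Strict Implicit.
Unset Printing Implicit Defensive.

Import Order.TTheory GRing.Theory Num.Theory.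
Import numFieldNormedType.Exports.

Local Open Scope classical_set_scope.
Local Open Scope ring_scope.

(* A graph with vertex type V is given by its set of edges, each edge being
   the two-element set of its ends.                                           *)
Definition simple_graph (V : finType) (E : {set {set V}}) : bool :=
  [forall e in E, #|e| == 2%N].

(* The subgraph need not be induced: edges go to edges, and nothing is asked
   of non-edges.                                                              *)
Definition contains_subgraph (W V : finType)
    (H : {set {set W}}) (E : {set {set V}}) : bool :=
  [exists f : {ffun W -> V},
    injectiveb f && [forall e in H, [set f x | x in e]%SET \in E]].

Definition subgraph_free (W V : finType)
    (H : {set {set W}}) (E : {set {set V}}) : bool :=
  ~~ contains_subgraph H E.

(* S_{a,b}: the centres are u = inl false, with leaves inr (inl i), i < a,
   and v = inl true, with leaves inr (inr j), j < b.                          *)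
Definition double_star (a b : nat) : {set {set (bool + ('I_a + 'I_b))}} :=
  ([set [set inl false; inl true]]
   :|: [set [set inl false; inr (inl i)] | i : 'I_a]
   :|: [set [set inl true; inr (inr j)] | j : 'I_b])%SET.

(* The edge e is drawn as the arc gamma e, a continuous injective image of
   [0, 1] joining the points that represent the two ends of e (in either
   direction); arcs meet vertices and each other only at common ends.  The
   values of gamma outside E and of gamma e outside [0, 1] are irrelevant.    *)
Definition plane_drawing (R : realType) (V : finType) (E : {set {set V}})
    (p : V -> R * R) (gamma : {set V} -> R -> R * R) : Prop :=
  [/\ injective p,
      forall e, e \in E ->
        [/\ {within `[0, 1], continuous (gamma e)},
            {in `[0, 1] &, injective (gamma e)} &
            [set gamma e 0; gamma e 1] = p @` [set` e]],
      forall e t v, e \in E -> t \in `]0, 1[ -> gamma e t <> p v &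
      forall e e' t t', e \in E -> e' \in E -> e != e' ->
        t \in `]0, 1[ -> t' \in `]0, 1[ -> gamma e t <> gamma e' t'].

Definition planar (R : realType) (V : finType) (E : {set {set V}}) : Prop :=
  exists (p : V -> R * R) (gamma : {set V} -> R -> R * R),
    plane_drawing E p gamma.

(* The planar Turan number ex_P(n, H); graphs on n vertices are taken, up to
   isomorphism, on the vertex set 'I_n.  As soon as H has an edge the edgeless
   graph is a candidate, so that the maximum is not over an empty family.     *)
Definition ex_planar (R : realType) (n : nat) (W : finType)
    (H : {set {set W}}) : nat :=
  \max_(E : {set {set 'I_n}} |
          [&& simple_graph E, `[< planar R E >] & subgraph_free H E]) #|E|.

(* Main.v *)
(* Call a graph weakly drawn if its vertices are points of the plane and each
   edge comes with a chain of small steps joining its ends, the chains of two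
   edges without a common end staying far apart.  By compactness and
   connectedness of arcs a plane drawing yields a weak one, and weak drawings
   survive contraction of an edge: concatenate chains.  K5 has none.  For
   steps ab and ce far from each other, count modulo 2 the crossings of ab
   with the upward rays from c and e and those of ce with the rays from a and
   b; the total depends only on the horizontal order of the four points.
   Telescoping along the chains and summing over the 15 pairs of independent
   edges of K5 gives 0 = 1.  Hence weakly drawn graphs have no K5 minor and, by
   Mader's contraction argument, at most 3n - 6 edges.

   For the upper bound, induct on the vertex set.  Up to 12 vertices the
   bound 3n - 6 suffices; vertices of degree at most 2 can be deleted.  If all
   degrees are at least 3, then S_{2,5}-freeness excludes degrees above 7,
   makes the closed neighbourhood of a vertex of degree 7 a union of
   components, and leaves each neighbour of a vertex v of degree 6 at most one
   neighbour outside N[v].  In the latter case, either the complement of N[v]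
   splits into two parts without edges between them, and induction gains
   18/7 twice, or it contracts to a single vertex and 3n - 6 applies to the
   resulting graph on 8 vertices.  If all degrees are at most 5, count edges.
   For n = 12 the icosahedron is 5-regular and has 30 edges. *)
Require Import Defs.
From mathcomp Require Import all_boot all_order all_algebra.
From mathcomp Require Import all_classical all_reals all_analysis.
From mathcomp Require Import zify lra.
From Stdlib Require Import Ring.

Set Implicit Arguments.
Unset Strict Implicit.
Unset Printing Implicit Defensive.

Import Order.TTheory GRing.Theory Num.Theory.
Import numFieldNormedType.Exports.

(** * Chains in the plane and the complete graph on five vertices *)

(** Parities are added in the field with two elements; registering it lets [ring] cancel repeated
    terms in the identities below. *)
Lemma addb_ring :
  ring_theory false true addb andb addb (fun b : bool => b) (@eq bool).
Proof. by split=> // [] [] // [] // []. Qed.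

Lemma eqb_imp_eq (a b : bool) : (a == b) = true -> a = b.
Proof. by move/eqP. Qed.

Add Ring addb_ring : addb_ring (decidable eqb_imp_eq, constants [bool_cst]).

Lemma uniq_take_drop (T : eqType) (n : nat) (s : seq T) :
  uniq s -> uniq (take n s ++ drop n.+1 s).
Proof.
apply: subseq_uniq; rewrite -[X in subseq _ X](cat_take_drop n) cat_subseq //.
by rewrite -add1n -drop_drop drop_subseq.
Qed.

Section WeakDrawing.

Variables (R : realDomainType) (d : R).
Local Open Scope ring_scope.

Definition close_pts : rel (R * R) :=
  fun x y => (`|x.1 - y.1| < d) && (`|x.2 - y.2| < d).

(** The margin of two step lengths ensures that, for two steps starting at far points, one
    coordinate orders all four pairs of their ends in the same way. *)
Definition far_pts : rel (R * R) :=
  fun x y => (d + d <= `|x.1 - y.1|) || (d + d <= `|x.2 - y.2|).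

(** Breaking ties lexicographically amounts to a slight tilt of the vertical rays, so points with
    equal first coordinates cause no degeneracy. *)
Definition lexlt : rel (R * R) :=
  fun x y => (x.1 < y.1) || (x.1 == y.1) && (x.2 < y.2).

(* For nearby [a] and [b]: the step from [a] to [b] crosses the vertical ray
   issuing upwards from [y]. *)
Definition ray_step (a b y : R * R) : bool :=
  (lexlt a y (+) lexlt b y) && (y.2 < a.2).

Fixpoint ray_parity (x : R * R) (s : seq (R * R)) (y : R * R) : bool :=
  if s is x' :: s' then ray_step x x' y (+) ray_parity x' s' y else false.

Lemma far_lexlt x y : 0 < d -> far_pts x y -> lexlt y x = ~~ lexlt x y.
Proof.
rewrite /far_pts /lexlt => d0 H.
have {H} : (x.1 != y.1) || (x.2 != y.2).
  case/orP: H => H; apply/orP; [left|right]; apply/eqP => E;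
  move: H; rewrite E subrr normr0; lra.
case: (ltgtP x.1 y.1) => //= _; case: (ltgtP x.2 y.2) => //=.
Qed.

(** If the separation is horizontal, the order is the same for all four pairs and both sides vanish.
    If it is vertical, only rays from the lower step can hit the other one, and their two terms
    expand to the right-hand side. *)
Lemma ray_step_cell (a b c e : R * R) :
  close_pts a b -> close_pts c e -> far_pts a c ->
  ray_step a b c (+) ray_step a b e (+) ray_step c e a (+) ray_step c e b =
  lexlt a c (+) lexlt b c (+) lexlt a e (+) lexlt b e.
Proof.
rewrite /close_pts /far_pts !ltr_norml => /andP[/andP[? ?] /andP[? ?]].
move=> /andP[/andP[? ?] /andP[? ?]].
have d0 : 0 < d by lra.
rewrite !ler_normr.
case/orP => [/orP[H|H]|H].
- have Ha : forall x y : R * R, y.1 < x.1 ->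
      lexlt x y = false /\ lexlt y x = true.
    by move=> x y xy; rewrite /lexlt; split; case: ltgtP xy.
  have [E1 F1] := Ha a c ltac:(lra); have [E2 F2] := Ha b c ltac:(lra).
  have [E3 F3] := Ha a e ltac:(lra); have [E4 F4] := Ha b e ltac:(lra).
  by rewrite /ray_step E1 E2 E3 E4 F1 F2 F3 F4.
- have Ha : forall x y : R * R, x.1 < y.1 ->
      lexlt x y = true /\ lexlt y x = false.
    by move=> x y xy; rewrite /lexlt; split; case: ltgtP xy.
  have [E1 F1] := Ha a c ltac:(lra); have [E2 F2] := Ha b c ltac:(lra).
  have [E3 F3] := Ha a e ltac:(lra); have [E4 F4] := Ha b e ltac:(lra).
  by rewrite /ray_step E1 E2 E3 E4 F1 F2 F3 F4.
have Hl : forall x y : R * R, x.2 != y.2 -> lexlt y x = ~~ lexlt x y.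
  move=> x y; rewrite /lexlt.
  by case: (ltgtP x.1 y.1) => //= _; case: (ltgtP x.2 y.2).
have Hn (x y : R) : x < y \/ y < x -> x != y.
  by rewrite neq_lt => -[]->; rewrite ?orbT.
rewrite /ray_step.
have G1 := Hl a c (Hn a.2 c.2 ltac:(case/orP: H; lra)).
have G2 := Hl a e (Hn a.2 e.2 ltac:(case/orP: H; lra)).
have G3 := Hl b c (Hn b.2 c.2 ltac:(case/orP: H; lra)).
have G4 := Hl b e (Hn b.2 e.2 ltac:(case/orP: H; lra)).
rewrite G1 G2 G3 G4.
case/orP: H => H.
- have -> : c.2 < a.2 by lra.
  have -> : e.2 < a.2 by lra.
  have -> : (a.2 < c.2) = false by apply/negbTE; rewrite -leNgt; lra.
  have -> : (b.2 < c.2) = false by apply/negbTE; rewrite -leNgt; lra.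
  by do 4!case: lexlt.
- have -> : (c.2 < a.2) = false by apply/negbTE; rewrite -leNgt; lra.
  have -> : (e.2 < a.2) = false by apply/negbTE; rewrite -leNgt; lra.
  have -> : (a.2 < c.2) by lra.
  have -> : (b.2 < c.2) by lra.
  by do 4!case: lexlt.
Qed.

(** Cells are summed along the second chain; the terms at an interior point occur in two consecutive
    cells and cancel modulo 2. [ray_parity_square] then sums strips along the first chain. *)
Lemma ray_parity_strip (a b c : R * R) (s : seq (R * R)) :
  close_pts a b -> path close_pts c s -> all (far_pts a) (c :: s) ->
  ray_step a b c (+) ray_step a b (last c s)
    (+) ray_parity c s a (+) ray_parity c s b =
  lexlt a c (+) lexlt b c (+) lexlt a (last c s) (+) lexlt b (last c s).
Proof.
move=> ab; elim: s c => [|c' s IH] c /=.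
  by move=> _ _; rewrite !addbF addbb -addbA addbb.
move=> /andP[cc' ps] /andP[fc fs].
have Hc := ray_step_cell ab cc' fc; have Hs := IH _ ps fs.
have Hsum := congr2 addb Hc Hs.
transitivity (ray_step a b c (+) ray_step a b c' (+) ray_step c c' a
  (+) ray_step c c' b (+) (ray_step a b c' (+) ray_step a b (last c' s)
  (+) ray_parity c' s a (+) ray_parity c' s b)); first by ring.
by rewrite Hsum; ring.
Qed.

Lemma ray_parity_square (a c : R * R) (s t : seq (R * R)) :
  path close_pts a s -> path close_pts c t ->
  (forall x y, x \in a :: s -> y \in c :: t -> far_pts x y) ->
  ray_parity a s c (+) ray_parity a s (last c t)
    (+) ray_parity c t a (+) ray_parity c t (last a s) =
  lexlt a c (+) lexlt (last a s) c
    (+) lexlt a (last c t) (+) lexlt (last a s) (last c t).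
Proof.
move=> + pt; elim: s a => [|b s IH] a /= pS far; first by ring.
case/andP: pS => ab ps.
have fa : all (far_pts a) (c :: t).
  by apply/allP => y yt; apply: far => //; rewrite inE eqxx.
have Hc := ray_parity_strip ab pt fa.
have Hs := IH _ ps (fun x y xs yt => far x y (mem_behead (s := a :: b :: s) xs) yt).
have Hsum := congr2 addb Hc Hs.
transitivity (ray_step a b c (+) ray_step a b (last c t) (+) ray_parity c t a
  (+) ray_parity c t b (+) (ray_parity b s c (+) ray_parity b s (last c t)
  (+) ray_parity c t b (+) ray_parity c t (last b s))); first by ring.
by rewrite Hsum; ring.
Qed.


(* Only edges without a common end are required to be drawn apart; this
   condition survives edge contraction. *)
Definition weak_drawing (V : eqType) (r : rel V) (p : V -> R * R)
    (G : V -> V -> R * R -> Prop) : Prop :=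
  [/\ 0 < d,
      forall u v, r u v -> exists s, [/\ path close_pts (p u) s,
        last (p u) s = p v & forall z, z \in p u :: s -> G u v z] &
      forall u v w x y z, r u v -> r w x -> uniq [:: u; v; w; x] ->
        G u v y -> G w x z -> far_pts y z].

Definition square_parity (V : eqType) (p : V -> R * R)
    (a b : V) s (c e : V) t : bool :=
  ray_parity (p a) s (p c) (+) ray_parity (p a) s (p e)
    (+) ray_parity (p c) t (p a) (+) ray_parity (p c) t (p b).

Section K5.
Variables (V : eqType) (r : rel V) (p : V -> R * R).
Variable G : V -> V -> R * R -> Prop.
Hypothesis Gp : weak_drawing r p G.

Definition drawn_chain (u v : V) (s : seq (R * R)) : Prop :=
  [/\ r u v, path close_pts (p u) s,
      last (p u) s = p v & forall z, z \in p u :: s -> G u v z].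

Lemma drawn_chain_exists u v : r u v -> exists s, drawn_chain u v s.
Proof. by case: Gp => _ H _ ruv; have [s [? ? ?]] := H _ _ ruv; exists s. Qed.

Lemma square_parityE a b s c e t :
  drawn_chain a b s -> drawn_chain c e t -> uniq [:: a; b; c; e] ->
  square_parity p a b s c e t = lexlt (p a) (p c) (+) lexlt (p b) (p c)
    (+) lexlt (p a) (p e) (+) lexlt (p b) (p e).
Proof.
case: Gp => _ _ far [rab ps ls Gs] [rce pt lt Gt] U; rewrite /square_parity.
rewrite -ls -lt; apply: ray_parity_square => // x y xs yt.
exact: far rab rce U (Gs _ xs) (Gt _ yt).
Qed.

Lemma lexlt_flip a b s c e t :
  drawn_chain a b s -> drawn_chain c e t -> uniq [:: a; b; c; e] ->
  lexlt (p c) (p b) = true (+) lexlt (p b) (p c) /\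
  lexlt (p e) (p b) = true (+) lexlt (p b) (p e).
Proof.
case: Gp => d0 _ far [rab _ ls Gs] [rce _ lt Gt] U.
split; apply: far_lexlt d0 _; apply: far rab rce U (Gs _ _) (Gt _ _).
- by rewrite -ls mem_last.
- exact: mem_head.
- by rewrite -ls mem_last.
- by rewrite -lt mem_last.
Qed.

(** In the sum over the three perfect matchings every pair of vertices is compared twice. The pairs
    at [a] are compared in the same direction and cancel; the three others are compared in both
    directions and give 1 each. *)
Lemma K4_square_parity a b c e sab sac sae sbc sbe sce :
  drawn_chain a b sab -> drawn_chain a c sac -> drawn_chain a e sae ->
  drawn_chain b c sbc -> drawn_chain b e sbe -> drawn_chain c e sce ->
  uniq [:: a; b; c; e] ->
  square_parity p a b sab c e sce (+) square_parity p a c sac b e sbe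
    (+) square_parity p a e sae b c sbc = true.
Proof.
move=> ab ac ae bc be ce U.
have [U1 U2] : uniq [:: a; c; b; e] /\ uniq [:: a; e; b; c].
  move: U; rewrite /= !inE !negb_or.
  move=> /and4P[/and3P[-> -> ->] /andP[neq_bc neq_be] neq_ce _].
  by rewrite (eq_sym e b) (eq_sym c b) (eq_sym e c) neq_bc neq_be neq_ce.
rewrite (square_parityE ab ce U) (square_parityE ac be U1).
rewrite (square_parityE ae bc U2).
have [-> ->] := lexlt_flip ab ce U.
have [_ ->] := lexlt_flip ac be U1.
by ring.
Qed.

(* Each parity of a chain around a point enters two of the fifteen squares,
   so they sum to 0; but each of the five K4 contributes 1. *)
Lemma K5_not_drawable a b c e f :
  uniq [:: a; b; c; e; f] -> ~~ pairwise r [:: a; b; c; e; f].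
Proof.
move=> U; apply/negP => /= /and5P[/and5P[rab rac rae raf _]].
move=> /and4P[rbc rbe rbf _] /and3P[rce rcf _] /andP[ref _] _.
have [sab ab] := drawn_chain_exists rab; have [sac ac] := drawn_chain_exists rac.
have [sae ae] := drawn_chain_exists rae; have [saf af] := drawn_chain_exists raf.
have [sbc bc] := drawn_chain_exists rbc; have [sbe be] := drawn_chain_exists rbe.
have [sbf bf] := drawn_chain_exists rbf; have [sce ce] := drawn_chain_exists rce.
have [scf cf] := drawn_chain_exists rcf; have [sef ef] := drawn_chain_exists ref.
have U4 n := uniq_take_drop n U.
have H1 := K4_square_parity ab ac ae bc be ce (U4 4%N).
have H2 := K4_square_parity ab ac af bc bf cf (U4 3%N).
have H3 := K4_square_parity ab ae af be bf ef (U4 2%N).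
have H4 := K4_square_parity ac ae af ce cf ef (U4 1%N).
have H5 := K4_square_parity bc be bf ce cf ef (U4 0%N).
have := congr2 addb H1 (congr2 addb H2 (congr2 addb H3 (congr2 addb H4 H5))).
by rewrite [LHS](_ : _ = false) // /square_parity; ring.
Qed.
End K5.
End WeakDrawing.

(** * Contraction and the edge bound *)

Section Drawable.
Variables (R : realDomainType) (V : eqType).
Implicit Types (r : rel V) (x y u v : V).

Definition drawable r : Prop :=
  exists (d : R) (p : V -> R * R) (G : V -> V -> R * R -> Prop),
    weak_drawing d r p G.

(** The vertex type is kept: [x] takes over the edges of [y], and [y] stays behind as an isolated
    vertex, so repeated contraction needs no quotient. *)
Definition contract r x y : rel V :=
  fun u v => [&& u != y, v != y, u != v &
    [|| r u v, (u == x) && r y v | (v == x) && r u y]].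

Lemma drawable_sub r r' : subrel r' r -> drawable r -> drawable r'.
Proof.
move=> rr' [d [p [G [d0 dr far]]]]; exists d, p, G; split=> //.
  by move=> u v /rr'; apply: dr.
by move=> u v w x y z /rr' ruv /rr'; apply: far ruv.
Qed.

Lemma contract_sym r x y : symmetric r -> symmetric (contract r x y).
Proof.
move=> rs u v; rewrite /contract (eq_sym v u) (rs v u) (rs y v) (rs y u).
by case: (u != y); case: (v != y) => //=; rewrite [_ && r v y || _]orbC.
Qed.

Lemma contract_irr r x y : irreflexive (contract r x y).
Proof. by move=> u; rewrite /contract eqxx /= !andbF. Qed.

(** A new edge is routed through the chain of [xy] if necessary. Its region is the union of the
    regions of all old edges that [f] maps into its ends; independent new edges thus use only
    independent old ones, and [d] and [p] can be kept. *)
Lemma drawable_contract r x y : symmetric r -> irreflexive r -> r x y ->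
  drawable r -> drawable (contract r x y).
Proof.
move=> rs ri rxy [d [p [G [d0 dr far]]]].
have nxy : x != y by apply: contraTneq rxy => ->; rewrite ri.
pose f a := if a == y then x else a.
have fE a : a != y -> f a = a by rewrite /f => /negbTE->.
have fy : f y = x by rewrite /f eqxx.
exists d, p, (fun u v z => exists a b, [/\ r a b, f a \in [:: u; v],
  f b \in [:: u; v] & G a b z]); split=> //.
- move=> u v /and4P[uy vy uv]; case/or3P.
  + move=> ruv; have [s [ps ls Gs]] := dr _ _ ruv; exists s; split=> // z zs.
    by exists u, v; rewrite !fE // !inE !eqxx orbT; split=> //; apply: Gs.
  + case/andP=> /eqP ux ryv; rewrite ux.
    have [s [ps ls Gs]] := dr _ _ rxy; have [t [pt lt Gt]] := dr _ _ ryv.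
    exists (s ++ t); rewrite cat_path last_cat ls ps lt; split=> // z.
    rewrite -cat_cons mem_cat => /orP[/Gs Gz|zt].
      by exists x, y; rewrite fE // fy !inE !eqxx.
    exists y, v; rewrite fy fE // !inE !eqxx orbT; split=> //; apply: Gt.
    by rewrite inE zt orbT.
  + case/andP=> /eqP vx ruy; have ryx : r y x by rewrite rs.
    rewrite vx; have [s [ps ls Gs]] := dr _ _ ruy.
    have [t [pt lt Gt]] := dr _ _ ryx.
    exists (s ++ t); rewrite cat_path last_cat ls ps lt; split=> // z.
    rewrite -cat_cons mem_cat => /orP[/Gs Gz|zt].
      by exists u, y; rewrite fE // fy !inE !eqxx orbT.
    exists y, x; rewrite fy fE // !inE !eqxx orbT; split=> //; apply: Gt.
    by rewrite inE zt orbT.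
move=> u v w w' z z' _ _ U [a [b [rab fa fb Gz]]] [a' [b' [rab' fa' fb' Gz']]].
have rn c e : r c e -> c != e by apply: contraTneq => ->; rewrite ri.
have fn c e : f c \in [:: u; v] -> f e \in [:: w; w'] -> c != e.
  move=> fc fe; apply: contraTneq fe => <-.
  move: fc U; rewrite /= !inE !negb_or.
  by case/orP=> /eqP-> /and4P[/and3P[_ uw uw'] /andP[vw vw'] _ _]; apply/andP.
apply: far (rab) (rab') _ Gz Gz'.
by rewrite /= !inE !negb_or (rn _ _ rab) (rn _ _ rab') !fn.
Qed.

End Drawable.

(** * Doubled edge counts and their change under contraction *)

Section EdgeSum.
Import fintype boot.finset.
Variable V : finType.
Implicit Types (r : rel V) (A B S : {set V}) (x y u v : V).

(* For A = B every edge counts twice. *)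
Definition edge_sum r A B : nat := \sum_(u in A) \sum_(v in B) r u v.

Lemma edge_sumC r A B : symmetric r -> edge_sum r A B = edge_sum r B A.
Proof.
move=> rs; rewrite /edge_sum exchange_big; apply: eq_bigr => u _.
by apply: eq_bigr => v _; rewrite rs.
Qed.

Lemma edge_sumUl r A B S : [disjoint A & B] ->
  edge_sum r (A :|: B) S = edge_sum r A S + edge_sum r B S.
Proof.
by move=> AB; rewrite /edge_sum -bigU //; apply: eq_bigl => u; rewrite !inE.
Qed.

Lemma edge_sumU r A B : symmetric r -> [disjoint A & B] ->
  edge_sum r (A :|: B) (A :|: B) =
  edge_sum r A A + edge_sum r B B + 2 * edge_sum r A B.
Proof.
move=> rs AB; rewrite edge_sumUl // (edge_sumC A) // (edge_sumC B) //.
rewrite !edge_sumUl // (edge_sumC B A) //; lia.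
Qed.

Lemma edge_sum1l r x B : edge_sum r [set x] B = \sum_(v in B) r x v.
Proof. exact: big_set1. Qed.

Lemma edge_sum1 r x : irreflexive r -> edge_sum r [set x] [set x] = 0.
Proof. by move=> ri; rewrite edge_sum1l big_set1 ri. Qed.

Lemma edge_sumU1 r x S : symmetric r -> irreflexive r -> x \notin S ->
  edge_sum r (x |: S) (x |: S) = edge_sum r S S + 2 * \sum_(v in S) r x v.
Proof.
move=> rs ri xS; rewrite edge_sumU ?disjoints1 //.
by rewrite edge_sum1 // edge_sum1l.
Qed.

Lemma edge_sumD1 r x S : symmetric r -> irreflexive r -> x \in S ->
  edge_sum r S S = edge_sum r (S :\ x) (S :\ x) + 2 * \sum_(v in S :\ x) r x v.
Proof. by move=> rs ri xS; rewrite -{1 2}(setD1K xS) edge_sumU1 // !inE eqxx. Qed.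

Lemma leq_edge_sum r r' A B :
  {in A & B, forall u v, r u v -> r' u v} -> edge_sum r A B <= edge_sum r' A B.
Proof.
move=> rr'; apply: leq_sum => u uA; apply: leq_sum => v vB.
by case E : (r u v) => //; rewrite (rr' _ _ uA vB E).
Qed.


Lemma leq_edge_sum_card r S : irreflexive r -> edge_sum r S S <= #|S| * #|S|.-1.
Proof.
move=> ri; rewrite /edge_sum -sum_nat_const; apply: leq_sum => u uS.
rewrite (big_setD1 u) //= ri add0n.
have -> : #|S|.-1 = #|S :\ u| by rewrite (cardsD1 u S) uS.
by rewrite -sum1_card; apply: leq_sum => v _; case: (r u v).
Qed.

Lemma sum_rel_card r S u : \sum_(v in S) r u v = #|[set v in S | r u v]|.
Proof.
rewrite -sum1_card big_mkcond [RHS]big_mkcond; apply: eq_bigr => v _.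
by rewrite inE; case: (v \in S); case: (r u v).
Qed.

(** Contraction loses the edge [xy] itself, and for each common neighbour the two edges to [x] and
    [y] merge into one. *)
Lemma edge_sum_contract r x y S :
  symmetric r -> irreflexive r -> x \in S -> y \in S -> r x y ->
  edge_sum r S S = edge_sum (contract r x y) (S :\ y) (S :\ y) + 2
    + 2 * #|[set v in S | r x v && r y v]|.
Proof.
move=> rs ri xS yS rxy.
have nxy : x != y by apply: contraTneq rxy => ->; rewrite ri.
have xSy : x \in S :\ y by rewrite !inE nxy.
rewrite (edge_sumD1 rs ri yS) (edge_sumD1 rs ri xSy).
rewrite (edge_sumD1 (contract_sym _ _ rs) (contract_irr _ _ _) xSy).
rewrite (big_setD1 x xSy) /= (rs y x) rxy.
set T := S :\ y :\ x.
have -> : edge_sum (contract r x y) T T = edge_sum r T T.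
  apply: eq_bigr => u; rewrite !inE => /and3P[ux uy _].
  apply: eq_bigr => v; rewrite !inE => /and3P[vx vy _].
  rewrite /contract uy vy (negbTE vx) (negbTE ux) /= orbF.
  by case: eqVneq => // ->; rewrite ri.
have -> : \sum_(v in T) contract r x y x v = \sum_(v in T) (r x v || r y v).
  apply: eq_bigr => v; rewrite !inE => /and3P[vx vy _].
  by rewrite /contract nxy vy (eq_sym x v) vx eqxx (negbTE vx) /= ?orbF.
have -> : #|[set v in S | r x v && r y v]| = \sum_(v in T) (r x v && r y v).
  rewrite -sum1_card big_mkcond [RHS]big_mkcond; apply: eq_bigr => v _.
  rewrite !inE; case: eqVneq => [->|_]; first by rewrite ri andbF.
  case: eqVneq => [->|_] /=; first by rewrite ri !andbF.
  by case: (v \in S) => //; case: (_ && _).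
have : \sum_(v in T) r x v + \sum_(v in T) r y v =
  \sum_(v in T) (r x v || r y v) + \sum_(v in T) (r x v && r y v).
  by rewrite -!big_split /=; apply: eq_bigr => v _; case: (r x v); case: (r y v).
lia.
Qed.

End EdgeSum.

(** * Mader's bound and contraction of vertex sets *)

Section Mader.
Import fintype boot.finset.
Variables (R : realDomainType) (V : finType).
Implicit Types (r : rel V).

(** Contracting the rim edge [ab] leaves a triangle as rim, which forms a K5 together with [v] and
    [h]. *)
Lemma wheel4_not_drawable r v h a b c e : symmetric r -> irreflexive r ->
  uniq [:: v; h; a; b; c; e] -> all (r v) [:: h; a; b; c; e] ->
  all (r h) [:: a; b; c; e] -> [&& r a b, r b c, r c e & r e a] ->
  ~ drawable R r.
Proof.
move=> rs ri U /and5P[rvh rva rvb rvc /andP[rve _]].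
move=> /and5P[rha rhb rhc rhe _] /and4P[rab rbc rce rea] D.
have [d [p [G Gp]]] := drawable_contract rs ri rab D.
move: U; rewrite /= !inE !negb_or.
case/and5P=> /and5P[vh va vb vc ve] /and4P[ha hb hc he] /and3P[ab ac ae].
case/andP=> bc be /andP[ce _].
have := K5_not_drawable Gp (a := v) (b := h) (c := a) (e := c) (f := e).
rewrite /= !inE !negb_or vh va vc ve ha hc he ac ae ce /= => /(_ isT) /negP; apply.
rewrite /contract (eq_sym c b) (eq_sym e b) vh va vb vc ve ha hb hc he ac ae ab bc be ce.
by rewrite rvh rva rvc rve rha rhc rhe rce eqxx rbc (rs a e) rea !orbT.
Qed.


Definition spanning_wheel r (s : seq V) : bool :=
  if s is [:: h; a; b; c; e] then
    all (r h) [:: a; b; c; e] && [&& r a b, r b c, r c e & r e a]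
  else false.

(* The non-adjacent pairs among five vertices of minimum degree 3 form a
   matching; the wheels with hub and rim on the five vertices are listed. *)
Lemma mindeg3_spanning_wheel r (s : seq V) : symmetric r -> irreflexive r ->
  size s = 5 -> all (fun u => 3 <= count (r u) s) s ->
  exists2 t, perm_eq t s & spanning_wheel r t.
Proof.
move=> rs ri; case: s => [|a [|b [|c [|e [|f []]]]]] //= _.
(* Five choices of the hub, times three cyclic orders of the other four vertices. *)
pose L := [:: [:: a; b; e; c; f];
    [:: a; b; c; e; f];
    [:: a; b; c; f; e];
    [:: b; a; e; c; f];
    [:: b; a; c; e; f];
    [:: b; a; c; f; e];
    [:: c; a; e; b; f];
    [:: c; a; b; e; f];
    [:: c; a; b; f; e];
    [:: e; a; c; b; f];
    [:: e; a; b; c; f];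
    [:: e; a; b; f; c];
    [:: f; a; c; b; e];
    [:: f; a; b; c; e];
    [:: f; a; b; e; c]].
rewrite !ri !addn0 !add0n.
rewrite (rs b a) (rs c a) (rs e a) (rs f a) (rs c b) (rs e b) (rs f b).
rewrite (rs e c) (rs f c) (rs f e) => rc.
have : has (spanning_wheel r) L.
  rewrite /L /=.
  rewrite (rs b a) (rs c a) (rs e a) (rs f a) (rs c b) (rs e b) (rs f b).
  rewrite (rs e c) (rs f c) (rs f e).
  (* The ten adjacencies become free booleans, and all 1024 graphs are checked by computation. *)
  apply: (implyP _ rc); move: (r a b) (r a c) (r a e) (r a f) (r b c).
  move: (r b e) (r b f) (r c e) (r c f) (r e f).
  by do 10!case; exact isT.
pose Q t := perm_eq t [:: a; b; c; e; f].
have perm5 h w x y z :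
    (forall q : pred V, q h + (q w + (q x + (q y + (q z + 0)))) =
       q a + (q b + (q c + (q e + (q f + 0))))) ->
    Q [:: h; w; x; y; z] by move=> ?; apply/seq.permP.
have /allP P : all Q L.
  by clearbody Q; rewrite /L /= !perm5 // => q; clear; lia.
by case/hasP=> t /P; exists t.
Qed.

Lemma deg5_not_drawable r v s : symmetric r -> irreflexive r ->
  uniq (v :: s) -> size s = 5 -> all (r v) s ->
  all (fun u => 3 <= count (r u) s) s -> ~ drawable R r.
Proof.
move=> rs ri U s5 rv /(mindeg3_spanning_wheel rs ri s5)[t ts].
have rvt : all (r v) t by rewrite (perm_all _ ts).
have Ut : uniq (v :: t) by rewrite cons_uniq (perm_mem ts) (perm_uniq ts).
case: t ts rvt Ut => [|h [|a [|b [|c [|e []]]]]] // _ rvt Ut /andP[rh rim].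
exact: wheel4_not_drawable Ut rvt rh rim.
Qed.

(** Contracting an edge with at most two common neighbours costs one vertex and at most three edges,
    which preserves the excess. If no such edge exists, the neighbourhood of a non-isolated vertex
    of degree at most 5 has minimum degree at least 3 and yields a K5 or a wheel. *)
Lemma mader r (S : {set V}) : symmetric r -> irreflexive r -> 3 <= #|S| ->
  6 * #|S| < edge_sum r S S + 12 -> ~ drawable R r.
Proof.
move: {-1}(edge_sum r S S + #|S|) (leqnn (edge_sum r S S + #|S|)) => m.
elim: m r S => [|m IH] r S; first by lia.
move=> le_m rs ri S3 eS D.
(* On three or four vertices even the complete graph meets the bound; from five on, a vertex can be
   removed. *)
have S5 : 5 <= #|S|.
  have := leq_edge_sum_card S ri.
  case: #|S| S3 eS => [|[|[|[|[|k]]]]] //= _; lia.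
case: (pickP [pred q : V * V | [&& q.1 \in S, q.2 \in S, r q.1 q.2 &
    #|[set v in S | r q.1 v && r q.2 v]| <= 2]])
    => [[x y] /= /and4P[xS yS rxy T2]|noT].
  have E := edge_sum_contract rs ri xS yS rxy.
  have := cardsD1 y S; rewrite yS => cS.
  apply: (IH (contract r x y) (S :\ y)) (drawable_contract rs ri rxy D).
  - lia.
  - exact: contract_sym.
  - exact: contract_irr.
  - lia.
  - lia.
(* An edge counts 2, so with an excess above 2 one edge can be deleted. Otherwise the degrees sum to
   at most 6|S| - 10, and some degree is at most 5. *)
case: (ltnP (6 * #|S| + 2) (edge_sum r S S + 12)) => [big|small].
  have [q /and3P[xS yS rxy]] :
      exists q : V * V, [&& q.1 \in S, q.2 \in S & r q.1 q.2].
    apply/existsP; apply: contraLR big => /existsPn H.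
    rewrite /edge_sum big1 => [|u uS]; first by lia.
    rewrite big1 // => v vS; apply/eqP; rewrite eqb0.
    by have := H (u, v); rewrite /= uS vS.
  case: q xS yS rxy => x y /= xS yS rxy.
  have nxy : x != y by apply: contraTneq rxy => ->; rewrite ri.
  pose r' u v := r u v && ([set u; v] != [set x; y]).
  have r's : symmetric r' by move=> u v; rewrite /r' rs setUC.
  have r'i : irreflexive r' by move=> u; rewrite /r' ri.
  have E : edge_sum r S S = edge_sum r' S S + 2.
    have yx : x \in S :\ y by rewrite !inE nxy.
    rewrite (edge_sumD1 rs ri yS) (edge_sumD1 r's r'i yS).
    rewrite (big_setD1 x yx) [in RHS](big_setD1 x yx) /= (rs y x) rxy.
    have -> : edge_sum r' (S :\ y) (S :\ y) = edge_sum r (S :\ y) (S :\ y).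
      apply: eq_bigr => u; rewrite !inE => /andP[uy _].
      apply: eq_bigr => v; rewrite !inE => /andP[vy _]; rewrite /r'.
      case: eqP => [/setP /(_ y)|]; rewrite ?andbT // !inE eqxx orbT.
      by rewrite eq_sym (negbTE uy) eq_sym (negbTE vy).
    have -> : \sum_(v in S :\ y :\ x) r' y v = \sum_(v in S :\ y :\ x) r y v.
      apply: eq_bigr => v; rewrite !inE => /and3P[vx _ _]; rewrite /r'.
      case: eqP => [/setP /(_ x)|]; rewrite ?andbT // !inE eqxx.
      by rewrite (negbTE nxy) eq_sym (negbTE vx).
    rewrite /r' setUC eqxx andbF; lia.
  apply: (IH r' S) => //; try lia.
  by apply: drawable_sub D => u v /andP[].
have [v vS dv5] : exists2 v, v \in S & \sum_(u in S) r v u <= 5.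
  apply/exists_inP; apply: contraLR small => /exists_inPn H.
  have : \sum_(u in S) 6 <= edge_sum r S S.
    by apply: leq_sum => u uS; have := H _ uS; rewrite -ltnNge.
  by rewrite sum_nat_const; lia.
case: (posnP (\sum_(u in S) r v u)) => [dv0|].
  have := cardsD1 v S; rewrite vS => cS.
  have := edge_sumD1 rs ri vS; move: dv0; rewrite (big_setD1 v vS) /= => E1 E2.
  by apply: (IH r (S :\ v)) D => //; lia.
rewrite sum_rel_card in dv5 *.
set N := [set u in S | r v u] in dv5 * => N0.
have degN u : u \in N -> 3 <= #|[set w in N | r u w]|.
  rewrite inE => /andP[uS rvu]; have /negbT := noT (v, u).
  rewrite /= vS uS rvu /= -ltnNge.
  congr (_ <= _); apply: eq_card => w; rewrite !inE.
  by rewrite andbA.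
have countN u : u \in N -> 3 <= count (r u) (enum N).
  move=> /degN; rewrite -size_filter cardE; congr (_ <= _).
  congr size; rewrite /enum_mem -filter_predI.
  by apply: eq_filter => w; rewrite !inE andbC.
have {}countN : all (fun u => 3 <= count (r u) (enum N)) (enum N).
  by apply/allP => u; rewrite mem_enum => /countN.
have vN : all (r v) (enum N).
  by apply/allP => u; rewrite mem_enum inE => /andP[].
have uN : uniq (v :: enum N).
  by rewrite /= enum_uniq mem_enum inE ri andbF.
have sN : size (enum N) = #|N| by rewrite -cardE.
move: (enum N) sN countN vN uN => s sN countN vN uN.
have {}N0 : 3 < size s.
  case: s sN countN vN uN => [|a s] /= sN; first by lia.
  by rewrite ri add0n => /andP[+ _] _ _; have := count_size (r a) s; lia.
(* Four neighbours of minimum degree 3 are pairwise adjacent and form a K5 with [v]; five are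
   handled by [deg5_not_drawable]. *)
case: s sN N0 countN vN uN => [|a [|b [|c [|e s]]]] //= sN _.
case: s sN => [|f [|g s]] /= sN; last by rewrite -sN in dv5.
  rewrite !ri !addn0 !add0n => /and5P[Ha Hb Hc _ _] vN uN.
  have [d [p [G Gp]]] := D.
  have /negP := K5_not_drawable Gp uN; apply => /=; rewrite vN andTb.
  have sum3 (x y z : bool) : 2 < x + (y + z) -> [&& x, y & z].
    by case: x; case: y; case: z.
  have /and3P[-> -> ->] := sum3 _ _ _ Ha; have /and3P[_ -> ->] := sum3 _ _ _ Hb.
  by have /and3P[_ _ ->] := sum3 _ _ _ Hc.
move=> cN vN uN.
exact: (deg5_not_drawable (s := [:: a; b; c; e; f]) rs ri uN erefl vN cN D).
Qed.

Lemma contract_map r x y a b (f := fun u => if u == y then x else u) :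
  r x y -> irreflexive r -> symmetric r -> r a b -> f a != f b ->
  contract r x y (f a) (f b).
Proof.
move=> rxy ri rs rab; have nxy : x != y.
  by apply: contraTneq rxy => ->; rewrite ri.
have fy u : f u != y by rewrite /f; case: ifP => // /negbT.
rewrite /contract !fy => -> /=; rewrite /f.
case: eqVneq rab => [->|ay]; case: eqVneq => [->|by_] rab;
  rewrite ?rab ?eqxx ?orbT //.
by rewrite ri in rab.
Qed.

(** Edges inside [B] are contracted one by one. Either a single vertex remains, which inherits all
    edges from outside, or the edges run out earlier; a separated part is then pulled back along the
    contraction maps. *)
Lemma split_or_contract r (B : {set V}) : symmetric r -> irreflexive r ->
  drawable R r -> B != set0 ->
  (exists B1 : {set V}, [/\ B1 != set0, B1 \proper B &
     {in B1 & B :\: B1, forall u v, ~~ r u v}]) \/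
  (exists w r', [/\ symmetric r', irreflexive r', drawable R r',
     w \in B & (forall u v, u \notin B -> v \notin B -> r u v -> r' u v) /\
       (forall u v, u \notin B -> v \in B -> r u v -> r' u w)]).
Proof.
move: {2}#|B| (leqnn #|B|) => m.
elim: m r B => [|m IH] r B; first by rewrite leqn0 cards_eq0 => ->.
move=> Bm rs ri D /set0Pn[b0 b0B].
case: (eqVneq B [set b0]) => [->|nB].
  right; exists b0, r; split=> //; first by rewrite inE.
  by split=> // u v _; rewrite inE => /eqP->.
case: (pickP [pred q : V * V | [&& q.1 \in B, q.2 \in B & r q.1 q.2]])
    => [[x y] /= /and3P[xB yB rxy]|noE]; last first.
  left; exists [set b0]; split; first by apply/set0Pn; exists b0; rewrite inE.
    by rewrite properEneq eq_sym nB sub1set.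
  move=> u v; rewrite !inE => /eqP-> /andP[_ vB].
  by have := noE (b0, v); rewrite /= b0B vB /= => ->.
have nxy : x != y by apply: contraTneq rxy => ->; rewrite ri.
have xB' : x \in B :\ y by rewrite !inE nxy.
pose f u := if u == y then x else u.
have fB u : u \in B -> f u \in B :\ y.
  by move=> uB; rewrite /f; case: eqVneq => // uy; rewrite !inE uy.
have fid u : u != y -> f u = u by rewrite /f => /negbTE->.
have [] := IH (contract r x y) (B :\ y).
- by move: Bm; rewrite (cardsD1 y) yB.
- exact: contract_sym.
- exact: contract_irr.
- exact: drawable_contract.
- by apply/set0Pn; exists x.
- case=> B1 [/set0Pn[z zB1] /properP[sB [t tB tB1]] noE]; left.
  have zB := subsetP sB _ zB1.
  exists [set b in B | f b \in B1]; split.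
  + apply/set0Pn; exists z; move: zB; rewrite !inE => /andP[zy ->].
    by rewrite fid.
  + apply/properP; split; first by apply/subsetP => b; rewrite inE => /andP[].
    move: tB; rewrite !inE => /andP[ty tB]; exists t => //.
    by rewrite inE tB fid.
  + move=> u v; rewrite !inE => /andP[uB uB1] /andP[vB1 vB].
    rewrite vB /= in vB1; apply: contra (noE (f u) (f v) uB1 _).
      move=> ruv; apply: contract_map => //.
      apply: contraNneq vB1 => /= fuv.
      by have -> : f v = f u by rewrite /f fuv.
    by rewrite in_setD vB1 fB.
- case=> w [r' [r's r'i D' wB [E1 E2]]]; right; exists w, r'; split=> //.
    by move: wB; rewrite inE => /andP[].
  have nB' u : u \notin B -> u \notin B :\ y /\ u != y.
    move=> uB; split; first by rewrite inE (negbTE uB) andbF.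
    by apply: contraNneq uB => ->.
  split=> u v uB vB ruv; have [uB' uy] := nB' u uB.
    have [vB' vy] := nB' v vB; apply: E1 => //.
    have : f u != f v -> contract r x y (f u) (f v) := contract_map rxy ri rs ruv.
    rewrite !fid //; apply.
    by apply: contraTneq ruv => ->; rewrite ri.
  apply: (E2 u (f v)) => //; first exact: fB.
  have : f u != f v -> contract r x y (f u) (f v) := contract_map rxy ri rs ruv.
  rewrite (fid u) //; apply.
  by apply: contraNneq uB' => ->; apply: fB.
Qed.

End Mader.

(** * Graphs without a double star *)

Section DoubleStar.
Import fintype boot.finset.
Variable V : finType.
Implicit Types (r : rel V) (S : {set V}).

Definition has_double_star r (a b : nat) : Prop :=
  exists u v s t, [/\ size s = a, size t = b, uniq (u :: v :: s ++ t),
    r u v & all (r u) s && all (r v) t].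

(** Here [u] is the centre with the two leaves [x] and [y], and [v] takes five leaves among its
    remaining neighbours. *)
Lemma double_star_at r S v u x y : symmetric r -> irreflexive r ->
  r v u -> x != v -> y != v -> x != y -> r u x -> r u y ->
  5 <= #|[set w in S | r v w] :\: [set u; x; y]| -> has_double_star r 2 5.
Proof.
move=> rs ri rvu xv yv xy rux ruy H.
set N := _ :\: _ in H; pose t := take 5 (enum N).
have tN w : w \in t -> w \in N by move/mem_take; rewrite mem_enum.
exists u, v, [:: x; y], t; split=> //.
- by rewrite size_take_min -cardE; apply/minn_idPl.
- have ne a b : r a b -> a != b by apply: contraTneq => ->; rewrite ri.
  have nt w : w \in [:: u; x; y; v] -> w \notin t.
    move=> ww; apply/negP => /tN; move: ww; rewrite !inE.
    by case/or4P => /eqP->; rewrite ?eqxx ?ri ?orbT ?andbF.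
  rewrite /= !inE !negb_or (eq_sym u v) (ne _ _ rvu) (ne _ _ rux) (ne _ _ ruy).
  rewrite (eq_sym v x) (eq_sym v y) xv yv xy !nt ?inE ?eqxx ?orbT //.
  by rewrite take_uniq ?enum_uniq.
- by rewrite rs.
- rewrite /= rux ruy /=; apply/allP => w /tN.
  by rewrite !inE => /and3P[].
Qed.

Lemma nbhd_removed_card r S v u x y : r v u -> u \in S ->
  #|[set w in S | r v w]| <= #|[set w in S | r v w] :\: [set u; x; y]| +
    1 + (x \in [set w in S | r v w]) + (y \in [set w in S | r v w]).
Proof.
move=> rvu uS; set N := [set w in S | _].
have -> : N :\: [set u; x; y] = N :\ u :\ x :\ y.
  apply/setP => w; rewrite !inE !negb_or.
  by case: (w == u); case: (w == x); case: (w == y).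
rewrite (cardsD1 u N) (cardsD1 x (N :\ u)) (cardsD1 y (N :\ u :\ x)).
have := leq_b1 (u \in N).
have : (x \in N :\ u) <= (x \in N).
  by rewrite in_setD; case: (x \in N); rewrite ?andbF ?leq_b1.
have : (y \in N :\ u :\ x) <= (y \in N).
  by rewrite !in_setD; case: (y \in N); rewrite ?andbF ?leq_b1.
lia.
Qed.

Variable r : rel V.
Hypotheses (rs : symmetric r) (ri : irreflexive r).
Hypothesis star_free : ~ has_double_star r 2 5.

Let N S v := [set w in S | r v w].

(** The two leaves at [u] may both be neighbours of [v], so up to three of the neighbours of [v] are
    spent and eight leave five. In the next two lemmas one or both leaves lie outside the
    neighbourhood, and seven or six suffice. *)
Lemma star_free_deg8 S v u : r v u -> u \in S -> 2 < #|N S u| -> #|N S v| < 8.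
Proof.
move=> rvu uS Nu; rewrite ltnNge; apply/negP => Nv; apply: star_free.
have : 1 < #|N S u :\ v| by have := cardsD1 v (N S u); lia.
case/card_gt1P => x [y [/setD1P[xv xN] /setD1P[yv yN] xy]].
move: xN yN; rewrite !inE => /andP[xS rux] /andP[yS ruy].
apply: (double_star_at (S := S) rs ri rvu xv yv xy rux ruy).
have := nbhd_removed_card x y rvu uS; rewrite -/(N S v); move: Nv; clear; lia.
Qed.

Lemma star_free_deg7 S v u w : r v u -> u \in S -> 2 < #|N S u| ->
  #|N S v| = 7 -> w \in S -> r u w -> w != v -> r v w.
Proof.
move=> rvu uS Nu Nv wS ruw wv; apply: contra_notT star_free => nvw.
have : 0 < #|N S u :\ v :\ w|.
  by have := cardsD1 v (N S u); have := cardsD1 w (N S u :\ v); lia.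
case/card_gt0P => y; rewrite !inE => /and4P[yw yv yS ruy].
rewrite eq_sym in yw.
apply: (double_star_at (S := S) rs ri rvu wv yv yw ruw ruy).
have := nbhd_removed_card w y rvu uS; rewrite /N in Nv.
rewrite Nv !inE (negbTE nvw) andbF; clear; lia.
Qed.

Lemma star_free_deg6 S v u : r v u -> u \in S -> #|N S v| = 6 ->
  #|[set w in S :\: (v |: N S v) | r u w]| <= 1.
Proof.
move=> rvu uS Nv; rewrite leqNgt; apply/negP => /card_gt1P[x [y []]].
rewrite !inE !negb_or => /andP[/andP[/andP[xv xN] xS] rux].
move=> /andP[/andP[/andP[yv yN] yS] ruy] xy; apply: star_free.
apply: (double_star_at (S := S) rs ri rvu xv yv xy rux ruy).
rewrite xS /= in xN; rewrite yS /= in yN.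
have := nbhd_removed_card x y rvu uS.
rewrite /N in Nv; rewrite Nv !inE (negbTE xN) (negbTE yN) !andbF; clear; lia.
Qed.

Variable R : realDomainType.
Hypothesis rD : drawable R r.

(** As [edge_sum] counts edges twice, this is the bound (19n - 18)/7. The form with a set [S]
    permits induction inside a fixed graph. *)
Lemma planar_star_free_edge_sum S : S != set0 ->
  7 * edge_sum r S S + 36 <= 38 * #|S|.
Proof.
move: {2}#|S| (leqnn #|S|) => m.
elim: m S => [|m IH] S; first by rewrite leqn0 cards_eq0 => ->.
move=> Sm S0; have Spos : 0 < #|S| by rewrite card_gt0.
have mader' (T : {set V}) : 3 <= #|T| -> edge_sum r T T + 12 <= 6 * #|T|.
  by move=> T3; rewrite leqNgt; apply/negP => H; exact: mader T3 H rD.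
(* The inequality 7(6n - 12) + 36 <= 38n holds exactly for n <= 12. *)
case: (leqP #|S| 12) => [S12|S13].
  case: (ltnP #|S| 3) => [S3|S3]; last by have := mader' _ S3; lia.
  have := leq_edge_sum_card S ri.
  by case: #|S| Spos S3 => [|[|[|k]]] //= _ _; lia.
(* The part [A] can be removed if at most 19|A|/7 edges meet it; the additive constant stays with
   [B]. *)
have remove (A B : {set V}) : A :|: B = S -> [disjoint A & B] ->
    0 < #|A| -> B != set0 ->
    7 * (edge_sum r A A + 2 * edge_sum r A B) <= 38 * #|A| ->
    7 * edge_sum r S S + 36 <= 38 * #|S|.
  move=> SE AB A0 B0 H; rewrite -SE in Sm *; rewrite edge_sumU //.
  have cAB : #|A :|: B| = #|A| + #|B| by apply/eqP; rewrite leq_card_setU.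
  have Bm : #|B| <= m by lia.
  have := IH B Bm B0; lia.
have removeN (A : {set V}) : A \subset S -> 0 < #|A| <= 12 ->
    7 * (edge_sum r A A + 2 * edge_sum r A (S :\: A)) <= 38 * #|A| ->
    7 * edge_sum r S S + 36 <= 38 * #|S|.
  move=> AS /andP[A0 A12]; apply: remove => //.
  - by rewrite -{1}(setIidPr AS) setID.
  - by rewrite disjoint_sym disjoints_subset setDE subsetIr.
  - rewrite -card_gt0 cardsD (setIidPr AS); lia.
case: (pickP [pred v | (v \in S) && (#|N S v| <= 2)]) => [v /= /andP[vS v2]|deg3].
  apply: (removeN [set v]); rewrite ?sub1set ?cards1 //.
  rewrite edge_sum1 // edge_sum1l sum_rel_card.
  have : #|[set w in S :\ v | r v w]| <= #|N S v|.
    apply: subset_leq_card; apply/subsetP => w.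
    by rewrite !inE => /andP[/andP[_ ->] ->].
  lia.
have {}deg3 v : v \in S -> 2 < #|N S v|.
  by move=> vS; have /negbT := deg3 v; rewrite /= vS /= -ltnNge.
have degN v : v \in S -> #|N S v| < 8.
  move=> vS; have /ltnW/ltnW/card_gt0P[u] := deg3 v vS.
  rewrite inE => /andP[uS rvu]; exact: star_free_deg8 rvu uS (deg3 u uS).
(* If all degrees are at most 5, then 35n + 36 <= 38n because n >= 13. *)
case: (pickP [pred v | (v \in S) && (6 <= #|N S v|)])
    => [v /= /andP[vS v6]|deg5]; last first.
  have : edge_sum r S S <= \sum_(u in S) 5.
    apply: leq_sum => u uS; rewrite sum_rel_card.
    by have /negbT := deg5 u; rewrite /= uS /= -ltnNge.
  by rewrite sum_nat_const; lia.
set A := v |: N S v.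
have vN : v \notin N S v by rewrite inE ri andbF.
have cA : #|A| = #|N S v|.+1 by rewrite cardsU1 vN.
have AS : A \subset S.
  by apply/subsetP => w; rewrite !inE => /orP[/eqP->|/andP[]].
have eAB : edge_sum r A (S :\: A) = edge_sum r (N S v) (S :\: A).
  rewrite edge_sumUl ?disjoints1 // edge_sum1l big1 // => w.
  by rewrite !inE negb_or => /andP[/andP[_ +] wS]; rewrite wS /= => /negbTE->.
have : (#|N S v| == 7) || (#|N S v| == 6) by have := degN v vS; lia.
have B0 : S :\: A != set0.
  by rewrite -card_gt0 cardsD (setIidPr AS); have := degN v vS; lia.
case/orP => /eqP Nv; rewrite Nv in cA.
  (* For degree 7 no edge leaves the eight vertices of [A], whose edge sum is at most 36, and 7 * 36
     <= 38 * 8. *)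
  apply: (removeN A) => //; first by rewrite cA.
  have -> : edge_sum r A (S :\: A) = 0.
    rewrite eAB /edge_sum big1 // => u; rewrite inE => /andP[uS rvu].
    rewrite big1 // => w; rewrite !inE negb_or => /andP[/andP[wv nvw] wS].
    apply/eqP; rewrite eqb0; apply: contra nvw => ruw.
    by rewrite wS (star_free_deg7 rvu uS (deg3 u uS) Nv wS ruw wv).
  have : edge_sum r A A + 12 <= 6 * #|A| by apply: mader'; rewrite cA.
  rewrite cA; lia.
have out u : u \in N S v -> \sum_(w in S :\: A) r u w <= 1.
  by rewrite inE => /andP[uS rvu]; rewrite sum_rel_card; apply: star_free_deg6.
have : edge_sum r A A + 12 <= 6 * #|A| by apply: mader'; rewrite cA.
rewrite cA => eA.
(* Edge sum 30 inside [A] and six edges leaving it give 7 * 42 = 294, which is 28 more than 38 * 7.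
   In the split case the second constant 36 covers this. *)
have eAB6 : edge_sum r A (S :\: A) <= 6.
  rewrite eAB -Nv -[leqRHS]muln1 -sum_nat_const; exact: leq_sum.
(* Both parts of S :\: A receive the additive constant of the bound. *)
case: (split_or_contract rs ri rD B0) => [[B1 [B10 B1B noB]]|].
  set B2 := S :\: A :\: B1 in noB.
  have B20 : B2 != set0.
    apply: contraTneq B1B; rewrite /B2 => /eqP.
    by rewrite setD_eq0 properE => ->; rewrite andbF.
  have B1S := proper_sub B1B.
  have eB : edge_sum r (S :\: A) (S :\: A) = edge_sum r B1 B1 + edge_sum r B2 B2.
    have -> : S :\: A = B1 :|: B2 by rewrite /B2 -{1}(setIidPr B1S) setID.
    rewrite edge_sumU //; last first.
      by rewrite disjoint_sym disjoints_subset /B2 setDE subsetIr.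
    rewrite [edge_sum r B1 B2]big1 ?addn0 // => u uB1.
    by rewrite big1 // => w wB2; rewrite (negbTE (noB _ _ uB1 wB2)).
  have cB : #|S :\: A| = #|B1| + #|B2|.
    by rewrite -(cardsID B1 (S :\: A)) (setIidPr B1S).
  have cS : #|S| = #|A| + #|S :\: A| by rewrite -(cardsID A S) (setIidPr AS).
  have eS : edge_sum r S S = edge_sum r A A + edge_sum r (S :\: A) (S :\: A)
      + 2 * edge_sum r A (S :\: A).
    rewrite -edge_sumU //; last first.
      by rewrite disjoint_sym disjoints_subset setDE subsetIr.
    by rewrite -{1 3}(setIidPr AS) setID.
  have [B1pos B2pos] : 0 < #|B1| /\ 0 < #|B2| by rewrite !card_gt0.
  have B1m : #|B1| <= m by lia.
  have B2m : #|B2| <= m by lia.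
  have := IH B1 B1m B10; have := IH B2 B2m B20; lia.
(* A vertex of A has at most one neighbour in S :\: A, hence no edge leaving A
   is lost in the contraction. *)
case=> w [r' [r's r'i D' wB [E1 E2]]].
apply: (removeN A) => //; first by rewrite cA.
have wA : w \notin A by move: wB; rewrite in_setD => /andP[].
have AnB u : u \in A -> u \notin S :\: A by move=> uA; rewrite in_setD uA.
(* On these eight vertices the edge sum is at most 36, and 7 * 36 = 252 is below 38 * 7 = 266. *)
have : edge_sum r' (w |: A) (w |: A) + 12 <= 6 * #|w |: A|.
  rewrite leqNgt; apply/negP => H; apply: mader r's r'i _ H D'.
  by rewrite cardsU1 wA cA.
rewrite edge_sumU1 // cardsU1 wA cA.
have : edge_sum r A A <= edge_sum r' A A.
  by apply: leq_edge_sum => u u' uA u'A; apply: E1; apply: AnB.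
have : edge_sum r A (S :\: A) <= \sum_(u in A) r' w u.
  apply: leq_sum => u uA.
  case: (pickP [pred z | (z \in S :\: A) && r u z]) => [z /= /andP[zB ruz]|no].
    rewrite r's (E2 u z (AnB _ uA) zB ruz).
    move: uA; rewrite in_setU1 => /orP[/eqP uv|]; last exact: out.
    move: zB ruz; rewrite uv !inE negb_or => /andP[/andP[_ +] zS].
    by rewrite zS => /negP.
  rewrite big1 // => z zB; apply/eqP; rewrite eqb0.
  by have := no z; rewrite /= zB /= => ->.
lia.
Qed.
End DoubleStar.

(** * From plane drawings to weak drawings *)

Section Topology.
Local Open Scope classical_set_scope.
Local Open Scope ring_scope.
Variable R : realType.
Implicit Types (A B : set (R * R)) (x y : R * R).

Lemma close_ptsP (d : R) x y : reflect (ball x d y) (close_pts d x y).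
Proof. by apply: (iffP andP). Qed.

(** The points reachable from [x] by chains in [A] form a nonempty subset that is both open and
    closed in [A]. *)
Lemma connected_chain A (d : R) x y : 0 < d -> connected A -> A x -> A y ->
  exists s, [/\ path (close_pts d) x s, last x s = y &
    forall z, z \in x :: s -> A z].
Proof.
move=> d0 cA Ax Ay.
pose C := [set z | exists s, [/\ path (close_pts d) x s, last x s = z &
    forall z, z \in x :: s -> A z]].
have Cstep a b : C a -> A b -> close_pts d a b -> C b.
  move=> [s [ps ls As]] Ab ab; exists (rcons s b); split.
  - by rewrite rcons_path ps ls.
  - by rewrite last_rcons.
  - by move=> z; rewrite -rcons_cons mem_rcons inE => /orP[/eqP->|/As].
have CA : C `<=` A by move=> z [s [_ <- As]]; apply/As/mem_last.
have close_sym a b : close_pts d a b = close_pts d b a.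
  by rewrite /close_pts (distrC a.1) (distrC a.2).
suff CE : C = A by have : C y by rewrite CE.
apply: cA.
- by exists x, [::]; split=> // z; rewrite inE => /eqP->.
- exists (\bigcup_(a in C) ball a d).
    by apply: bigcup_open => a _; apply: ball_open.
  apply/seteqP; split=> [z Cz|z [Az [a Ca /close_ptsP az]]].
    by split; [exact: CA|exists z => //; exact: ballxx].
  exact: Cstep az.
- exists (~` \bigcup_(b in A `\` C) ball b d).
    by apply: open_closedC; apply: bigcup_open => a _; apply: ball_open.
  apply/seteqP; split=> [z Cz|z [Az nz]].
    split; first exact: CA.
    move=> [b [Ab nCb] /close_ptsP]; rewrite close_sym => zb.
    by apply: nCb; apply: Cstep zb.
  apply: contrapT => nCz; apply: nz; exists z => //; exact: ballxx.
Qed.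

(** If the ball of radius [e] around [a] misses [B], then any [d < e / 4] works for all points
    within [e / 2] of [a]; compactness of [A] makes the choice uniform. *)
Lemma compact_far A B : compact A -> compact B -> A `&` B = set0 ->
  \forall d \near (0 : R)^'+, forall a b, A a -> B b -> far_pts d a b.
Proof.
move=> cA cB AB0.
have hR : hausdorff_space (R * R)%type by exact: norm_hausdorff.
have /compact_near_coveringP nA := cA.
suff H : \forall d \near (0 : R)^'+,
    A `<=` (fun a => forall b, B b -> far_pts d a b).
  by apply: filterS H => d H a b /H; apply.
apply: nA => a Aa.
have nBa : nbhs a (~` B).
  apply: open_nbhs_nbhs; split.
    by apply: closed_openC; apply: compact_closed.
  by move=> Ba; have : (A `&` B) a by []; rewrite AB0.
have /nbhs_ballP[e /= e0 eB] := nBa.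
exists (ball a (e / 2), [set d | d < e / 4]).
  split=> /=; first by apply: nbhsx_ballx; lra.
  by apply: nbhs_right_lt; lra.
move=> [a' d] /= [[a1 a2] de] b Bb.
apply: contrapT => /negP; rewrite /far_pts negb_or -!ltNge => /andP[b1 b2].
rewrite /ball /= in a1 a2.
apply: (eB b) => //; split; rewrite /ball /=.
  by have := ler_distD a'.1 a.1 b.1; lra.
by have := ler_distD a'.2 a.2 b.2; lra.
Qed.

End Topology.

Section PlanarDrawable.
Local Open Scope classical_set_scope.
Local Open Scope ring_scope.
Variables (R : realType) (V : finType) (E : {set {set V}}).

(** The condition [u != v] discards singletons in [E], so irreflexivity holds for every [E]. *)
Definition adjacent : rel V := fun u v => (u != v) && ([set u; v]%SET \in E).

Lemma adjacent_sym : symmetric adjacent.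
Proof. by move=> u v; rewrite /adjacent eq_sym finset.setUC. Qed.

Lemma adjacent_irr : irreflexive adjacent.
Proof. by move=> u; rewrite /adjacent eqxx. Qed.

(** The region of an edge is its whole arc: connectedness supplies the chains, and compactness keeps
    the arcs of disjoint edges apart. *)
Lemma planar_drawable : planar R E -> drawable R adjacent.
Proof.
move=> [p [g [injp arc vtx crossing]]].
pose K e : set (R * R) := g e @` `[0, 1].
have K01 e : e \in E -> p @` [set` e] `<=` K e.
  move=> eE; have [_ _ <-] := arc e eE.
  move=> z [->|->]; [exists 0|exists 1] => //=;
    rewrite in_itv /=; apply/andP; split; lra.
have Kcompact e : e \in E -> compact (K e).
  move=> eE; have [cg _ _] := arc e eE.
  by apply: continuous_compact cg _; apply: segment_compact.
have Kconnected e : e \in E -> connected (K e).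
  move=> eE; have [cg _ _] := arc e eE.
  by apply: connected_continuous_connected cg; apply: segment_connected.
have Kend e t : e \in E -> t \in `[0, 1] ->
    (t \in `]0, 1[%R) \/ (exists v, (v \in e) /\ g e t = p v).
  move=> eE t01; have [_ _ ends] := arc e eE.
  case: (eqVneq t 0) => [->|t0].
    right; have : (p @` [set` e]) (g e 0) by rewrite -ends; left.
    by case=> v ve pv; exists v.
  case: (eqVneq t 1) => [->|t1].
    right; have : (p @` [set` e]) (g e 1) by rewrite -ends; right.
    by case=> v ve pv; exists v.
  left; move: t01; rewrite !in_itv /= => /andP[t00 t11].
  by rewrite lt_def t0 t00 /= lt_def eq_sym t1 t11.
have Kdisj e e' : e \in E -> e' \in E -> [disjoint e & e']%B ->
    K e `&` K e' = set0.
  move=> eE e'E dis; apply/seteqP; split=> // z [[t t01 <-] [t' t'01 gE]].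
  have ne : e != e'.
    (* An edge disjoint from itself would be empty, but its arc starts at one of its vertices. *)
    apply: contraTneq dis => <-; rewrite -setI_eq0 finset.setIid.
    have [_ _ ends] := arc e eE; apply/set0Pn.
    have : (p @` [set` e]) (g e 0) by rewrite -ends; left.
    by case=> v ve _; exists v.
  case: (Kend e t eE t01) => [ti|[v [ve pv]]].
    case: (Kend e' t' e'E t'01) => [t'i|[v' [v'e pv']]].
      by apply: (crossing e e' t t').
    by apply: (vtx e t v' eE ti); rewrite -gE pv'.
  case: (Kend e' t' e'E t'01) => [t'i|[v' [v'e pv']]].
    by apply: (vtx e' t' v e'E t'i); rewrite gE pv.
  have vv' : v = v' by apply: injp; rewrite -pv -pv' gE.
  by move: dis => /pred0P/(_ v) /=; rewrite ve vv' v'e.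
have [d [d0 dfar]] : exists d : R, 0 < d /\ forall e e', e \in E -> e' \in E ->
    [disjoint e & e']%B -> forall a b, K e a -> K e' b -> far_pts d a b.
  have : \forall d \near (0 : R)^'+, forall q : {set V} * {set V},
      q.1 \in E -> q.2 \in E -> [disjoint q.1 & q.2]%B ->
      forall a b, K q.1 a -> K q.2 b -> far_pts d a b.
    (* There are finitely many pairs of edges, so one small [d] serves them all. *)
    apply: filter_forall => -[e e'] /=.
    case: (boolP [&& e \in E, e' \in E & [disjoint e & e']%B])
        => [/and3P[eE e'E dis]|no].
      apply: filterS (compact_far (Kcompact e eE) (Kcompact e' e'E)
        (Kdisj e e' eE e'E dis)) => d far _ _ _; exact: far.
    by apply: nearW => d eE e'E dis; move: no; rewrite eE e'E dis.
  move=> H.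
  have [d [/= d0 dH]] : exists d : R, 0 < d /\ forall q : {set V} * {set V},
      q.1 \in E -> q.2 \in E -> [disjoint q.1 & q.2]%B ->
      forall a b, K q.1 a -> K q.2 b -> far_pts d a b.
    have H0 : \forall d \near (0 : R)^'+, 0 < d by apply: nbhs_right_gt.
    have [d []] := filter_ex (filterI H0 H); by exists d.
  by exists d; split=> // e e' eE e'E dis; apply: (dH (e, e')).
exists d, p, (fun u v => K [set u; v]%SET); split=> //.
- move=> u v /andP[uv uvE]; apply: connected_chain => //.
  + exact: Kconnected.
  + by apply: K01 => //; exists u => //=; rewrite !inE eqxx.
  + by apply: K01 => //; exists v => //=; rewrite !inE eqxx orbT.
- move=> u v w x y z /andP[_ uvE] /andP[_ wxE] U; apply: dfar => //.
  move: U; rewrite /= !inE !negb_or => /and4P[/and3P[_ uw ux] /andP[vw vx] _ _].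
  by rewrite finset.disjoints_subset; apply/fintype.subsetP => s;
    rewrite !inE => /orP[] /eqP->; rewrite negb_or ?uw ?ux ?vw ?vx.
Qed.

End PlanarDrawable.

(** * Edge sets and adjacency relations *)

Section EdgeSets.
Local Open Scope classical_set_scope.
Local Open Scope ring_scope.
Variable V : finType.
Implicit Types (r : rel V) (E : {set {set V}}).

Lemma set2_eq (u v x y : V) : [set u; v]%SET = [set x; y]%SET ->
  (u = x /\ v = y) \/ (u = y /\ v = x).
Proof.
move=> H; have Hu : u \in [set x; y]%SET by rewrite -H !inE eqxx.
have Hv : v \in [set x; y]%SET by rewrite -H !inE eqxx orbT.
have Hx : x \in [set u; v]%SET by rewrite H !inE eqxx.
have Hy : y \in [set u; v]%SET by rewrite H !inE eqxx orbT.
move: Hu Hv Hx Hy; rewrite !inE.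
by case/orP=> /eqP ? /orP[] /eqP ? /orP[] /eqP ? /orP[] /eqP ?; subst; auto.
Qed.

(** Each edge is the image of exactly two ordered pairs of adjacent vertices. *)
Lemma edge_sum_adjacent E : simple_graph E ->
  edge_sum (adjacent E) [set: V]%SET [set: V]%SET = (2 * #|E|)%N.
Proof.
move=> /forall_inP sE.
transitivity (\sum_(q : V * V | adjacent E q.1 q.2) 1)%N.
  rewrite /edge_sum pair_big /= [RHS]big_mkcond; apply: eq_big => [q|q _].
    by rewrite !inE.
  by case: adjacent.
rewrite (partition_big (fun q : V * V => [set q.1; q.2]%SET) (mem E)) /=; last first.
  by move=> q /andP[].
rewrite -sum1_card big_distrr /=; apply: eq_bigr => e eE; rewrite muln1.
have /cards2P[x [y [xy ee]]] := sE e eE.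
rewrite sum1_card.
have -> : 2%N = #|[set (x, y); (y, x)]%SET|.
  by rewrite cards2 xpair_eqE negb_and xy.
apply: eq_card => -[u v]; rewrite !inE /= !xpair_eqE.
apply/andP/orP => [[/andP[uv _]] /eqP|].
  by rewrite ee => /set2_eq /= [[-> ->]|[-> ->]]; rewrite !eqxx; [left|right].
case=> /andP[/eqP-> /eqP->] /=.
  by rewrite /adjacent xy -ee eE eqxx.
by rewrite /adjacent eq_sym xy finset.setUC -ee eE eqxx.
Qed.

Lemma double_star_subgraph E a b : has_double_star (adjacent E) a b ->
  contains_subgraph (double_star a b) E.
Proof.
move=> [u [v [s [t [ss st U ruv /andP[/allP rs /allP rt]]]]]].
(* Positions in the list [u :: v :: s ++ t]; the centres [false] and [true] coerce to 0 and 1. *)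
pose ix (w : bool + ('I_a + 'I_b)) : nat := match w with
  | inl c => c | inr (inl i) => 2 + i | inr (inr j) => 2 + a + j end%N.
have ixinj : injective ix.
  move=> [c|[i|j]] [c'|[i'|j']] /= H.
  - by congr inl; case: c c' H => -[].
  - by move: H; case: c.
  - by move: H; case: c.
  - by move: H; case: c'.
  - by congr (inr (inl _)); apply/val_inj; move: H => /= [].
  - by exfalso; have := ltn_ord i; lia.
  - by move: H; case: c'.
  - by exfalso; have := ltn_ord i'; lia.
  - by congr (inr (inr _)); apply/val_inj => /=; lia.
have ixlt w : (ix w < size (u :: v :: s ++ t))%N.
  rewrite /= size_cat ss st; case: w => [[]|[i|j]] //=.
    by have := ltn_ord i; lia.
  by have := ltn_ord j; lia.
pose f := [ffun w => nth u (u :: v :: s ++ t) (ix w)].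
have f0 : f (inl false) = u by rewrite ffunE.
have f1 : f (inl true) = v by rewrite ffunE.
have fl i : f (inr (inl i)) \in s.
  by rewrite ffunE /= nth_cat ss ltn_ord mem_nth // ss ltn_ord.
have fr j : f (inr (inr j)) \in t.
  rewrite ffunE /= nth_cat ss ltnNge leq_addr /= addKn mem_nth //.
  by rewrite st ltn_ord.
apply/existsP; exists f; apply/andP; split.
  apply/injectiveP => w w'; rewrite !ffunE => /eqP; rewrite nth_uniq //.
  by move=> /eqP/ixinj.
apply/forall_inP => e; rewrite !inE.
move=> /orP[/orP[/eqP->|/imsetP[i _ ->]]|/imsetP[j _ ->]];
  rewrite imsetU1 imset_set1 ?f0 ?f1.
- by case/andP: ruv.
- by case/andP: (rs _ (fl i)).
- by case/andP: (rt _ (fr j)).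
Qed.

Lemma double_star_degree E a b : simple_graph E ->
  contains_subgraph (double_star a b) E ->
  exists v, (b < #|[set w | adjacent E v w]%SET|)%N.
Proof.
move=> /forall_inP sE /existsP[f /andP[/injectiveP fi /forall_inP H]].
exists (f (inl true)).
(* [None] stands for the other centre, which is the additional neighbour beyond the [b] leaves. *)
pose g (o : option 'I_b) := f (if o is Some j then inr (inr j) else inl false).
have gi : injective g by move=> [i|] [j|] /fi; [case=> ->| | |].
have <- : #|codom g| = b.+1 by rewrite card_codom // card_option card_ord.
apply: subset_leq_card; apply/fintype.subsetP => w /codomP[k ->]; rewrite inE.
have {H} : [set f (inl true); g k]%SET \in E.
  case: k => [j|] /=.
    have := H [set inl true; inr (inr j)]%SET; rewrite imsetU1 imset_set1; apply.
    by rewrite !inE; apply/orP; right; apply/imsetP; exists j.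
  rewrite finset.setUC.
  have := H [set inl false; inl true]%SET; rewrite imsetU1 imset_set1; apply.
  by rewrite !inE eqxx.
move=> gE; rewrite /adjacent gE andbT.
have /eqP := sE _ gE; rewrite cards2; case: eqP => //.
Qed.

Definition edges_of r : {set {set V}} :=
  [set [set q.1; q.2]%SET | q : V * V & r q.1 q.2]%SET.

Lemma adjacent_edges_of r : symmetric r -> irreflexive r ->
  adjacent (edges_of r) =2 r.
Proof.
move=> rs ri u v; rewrite /adjacent; apply/andP/idP.
  move=> [_ /imsetP[[x y]]]; rewrite inE /= => rxy /set2_eq[[-> ->]|[-> ->]] //.
  by rewrite rs.
move=> ruv; split; first by apply: contraTneq ruv => ->; rewrite ri.
by apply/imsetP; exists (u, v); rewrite ?inE.
Qed.

Lemma simple_edges_of r : irreflexive r -> simple_graph (edges_of r).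
Proof.
move=> ri; apply/forall_inP => e /imsetP[[x y]]; rewrite inE /= => rxy ->.
by rewrite cards2; have -> : x != y by apply: contraTneq rxy => ->; rewrite ri.
Qed.

End EdgeSets.

Local Open Scope ring_scope.

(** * The icosahedron *)

(** Twice the signed area of the triangle [a], [b], [c], over a ring general enough for both integer
    and real coordinates. *)
Definition orient (K : pzRingType) (a b c : K * K) : K :=
  (b.1 - a.1) * (c.2 - a.2) - (b.2 - a.2) * (c.1 - a.1).

(* Both [c] and [d] lie weakly on the same side of the line through [a] and
   [b], and not both on it, so that the open segment from [c] to [d] misses
   that line. *)
Definition open_side (K : numDomainType) (a b c d : K * K) : bool :=
  [&& 0 <= orient a b c, 0 <= orient a b d & 0 < orient a b c + orient a b d]
  || [&& orient a b c <= 0, orient a b d <= 0 & orient a b c + orient a b d < 0].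

Definition segment_point (R : realType) (a b : R * R) (t : R) : R * R :=
  ((1 - t) * a.1 + t * b.1, (1 - t) * a.2 + t * b.2).

(** * Straight-line drawings *)

Section StraightLine.
Variable R : realType.

Lemma orient_segment (a b c e : R * R) (t : R) :
  orient a b (segment_point c e t) = (1 - t) * orient a b c + t * orient a b e.
Proof. by rewrite /orient /=; lra. Qed.

Lemma orient_on_segment (a b : R * R) (t : R) : orient a b (segment_point a b t) = 0.
Proof. by rewrite /orient /=; lra. Qed.

Lemma open_side_segment (a b c e : R * R) (t : R) :
  0 < t < 1 -> open_side a b c e ->
  orient a b (segment_point c e t) != 0.
Proof.
move=> /andP[t0 t1] H; rewrite orient_segment; apply/eqP.
case/orP: H => /and3P[]; move: (orient a b c) (orient a b e) => x y.
  case: (ltgtP x 0) => // [x0|->] _ y0 xy; [nra|].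
  by rewrite mulr0 add0r => /eqP; rewrite mulf_eq0; lra.
case: (ltgtP x 0) => // [x0|->] _ y0 xy; [nra|nra].
Qed.

Lemma segment_point_continuous (a b : R * R) : continuous (segment_point a b).
Proof.
have aff (u v : R) : continuous (fun t : R => (1 - t) * u + t * v).
  move=> t; apply: cvgD; apply: cvgM; last exact: cvg_cst.
  - by apply: cvgB; [exact: cvg_cst|exact: cvg_id].
  - exact: cvg_cst.
  - exact: cvg_id.
by move=> t; exact: (cvg_pair (aff a.1 b.1 t) (aff a.2 b.2 t)).
Qed.

Lemma segment_point_inj (a b : R * R) : a != b -> injective (segment_point a b).
Proof.
move=> ab s t [E1 E2]; apply: contraNeq ab => st.
have nz : t - s != 0 by rewrite subr_eq0 eq_sym.
case: a b E1 E2 => [a1 a2] [b1 b2] /= E1 E2.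
have F1 : (t - s) * (b1 - a1) = 0.
  by rewrite -(subrr ((1 - t) * a1 + t * b1)) -{2}E1; lra.
have F2 : (t - s) * (b2 - a2) = 0.
  by rewrite -(subrr ((1 - t) * a2 + t * b2)) -{2}E2; lra.
move/eqP: F1; rewrite mulf_eq0 (negbTE nz) /= subr_eq0 => /eqP->.
by move/eqP: F2; rewrite mulf_eq0 (negbTE nz) /= subr_eq0 => /eqP->.
Qed.

Variables (V : finType) (r : rel V) (p : V -> R * R).
Hypotheses (ri : irreflexive r) (p_inj : injective p).
Hypothesis vertex_off : forall a b v : V, r a b -> v != a -> v != b ->
  orient (p a) (p b) (p v) != 0.
Hypothesis edges_apart : forall a b c e : V, r a b -> r c e ->
  [set a; b]%SET != [set c; e]%SET ->
  open_side (p a) (p b) (p c) (p e) || open_side (p c) (p e) (p a) (p b).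

(** For one of any two edges, the interior of the other misses its line, on which [orient] vanishes;
    this also covers edges with a common end. *)
Lemma straight_line_planar : planar R (edges_of r).
Proof.
(* Each edge gets a chosen direction; [g] takes the dummy value 0 on sets that are not edges. *)
pose ends e := [pick q : V * V | (e == [set q.1; q.2]%SET) && r q.1 q.2].
pose g e (t : R) := if ends e is Some q then segment_point (p q.1) (p q.2) t else 0.
have gP e : e \in edges_of r -> exists a b , [/\ e = [set a; b]%SET, r a b &
    g e = segment_point (p a) (p b)].
  move=> /imsetP[q]; rewrite inE => rq eq; rewrite /g /ends.
  case: pickP => [[a b] /= /andP[/eqP-> rab]|/(_ q)]; first by exists a, b.
  by rewrite eq eqxx rq.
have g0 (a b : V) : segment_point (p a) (p b) 0 = p a.
  by rewrite /segment_point; case: (p a) => x y /=; congr pair; lra.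
have g1 (a b : V) : segment_point (p a) (p b) 1 = p b.
  by rewrite /segment_point; case: (p b) => x y /=; congr pair; lra.
have neq (a b : V) : r a b -> p a != p b.
  by move=> rab; apply: contraTneq rab => /p_inj->; rewrite ri.
exists p, g; split=> //.
- move=> e /gP[a [b [-> rab ->]]]; split.
  + by apply: continuous_subspaceT; apply: segment_point_continuous.
  + by move=> s t _ _; apply: segment_point_inj; apply: neq.
  + rewrite g0 g1; apply/seteqP; split=> [z [->|->]|z [v /= + <-]].
    * by exists a => //=; rewrite !inE eqxx.
    * by exists b => //=; rewrite !inE eqxx orbT.
    * by rewrite !inE => /orP[] /eqP->; [left|right].
- move=> e t v /gP[a [b [_ rab ->]]]; rewrite in_itv /= => /andP[t0 t1] E.
  case: (eqVneq v a) => [va|va].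
    rewrite va in E; move: t0.
    by rewrite (segment_point_inj (neq _ _ rab) (etrans E (esym (g0 a b)))) ltxx.
  case: (eqVneq v b) => [vb|vb].
    rewrite vb in E; move: t1.
    by rewrite (segment_point_inj (neq _ _ rab) (etrans E (esym (g1 a b)))) ltxx.
  by have := vertex_off rab va vb; rewrite -E orient_on_segment eqxx.
- move=> e e' t t' /gP[a [b [-> rab ->]]] /gP[c [f [-> rcf ->]]] ne.
  rewrite !in_itv /= => t01 t'01 E.
  case/orP: (edges_apart rab rcf ne) => H.
    by have := open_side_segment t'01 H; rewrite -E orient_on_segment eqxx.
  by have := open_side_segment t01 H; rewrite E orient_on_segment eqxx.
Qed.

End StraightLine.

Definition icosahedron_edges : seq (nat * nat) :=
  [:: (0, 1); (0, 2); (0, 3); (0, 4); (0, 8); (1, 2); (1, 4); (1, 5); (1, 6);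
      (2, 6); (2, 7); (2, 8); (3, 4); (3, 8); (3, 9); (3, 11); (4, 5); (4, 9);
      (5, 6); (5, 9); (5, 10); (6, 7); (6, 10); (7, 8); (7, 10); (7, 11);
      (8, 11); (9, 10); (9, 11); (10, 11)]%N.

(** Grid points of a straight-line drawing whose outer face is the triangle on 0, 1 and 2. *)
Definition icosahedron_points : seq (int * int) :=
  [:: (0, 0); (9, 3); (1, 9); (1, 2); (5, 2); (6, 3); (6, 5); (4, 6); (2, 6);
      (3, 4); (5, 4); (3, 5)].

Definition ico_adj (i j : nat) : bool :=
  ((i, j) \in icosahedron_edges) || ((j, i) \in icosahedron_edges).

Definition ico_point (i : nat) : int * int := nth 0 icosahedron_points i.

Definition icosahedron : rel 'I_12 := fun i j => ico_adj i j.

(** Turns quantification over ordinals into a closed boolean that [vm_compute] evaluates. *)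
Lemma forall_ord n (P : pred nat) : all P (iota 0 n) -> forall i : 'I_n, P i.
Proof. by move=> /allP H i; apply: H; rewrite mem_iota ltn_ord. Qed.

Lemma forall_ord2 n (P : nat -> nat -> bool) :
  all (fun i => all (P i) (iota 0 n)) (iota 0 n) -> forall i j : 'I_n, P i j.
Proof. by move=> H i j; apply/forall_ord/(forall_ord (P := fun i => all (P i) _)). Qed.

Lemma icosahedron_sym : symmetric icosahedron.
Proof. by move=> i j; rewrite /icosahedron /ico_adj orbC. Qed.

Lemma icosahedron_irr : irreflexive icosahedron.
Proof.
move=> i; apply/negbTE; apply: (forall_ord (P := fun i => ~~ ico_adj i i)).
by vm_compute.
Qed.

Lemma icosahedron_degree (i : 'I_12) : (\sum_(j < 12) icosahedron i j = 5)%N.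
Proof.
rewrite -(big_mkord xpredT (fun j => ico_adj i j : nat)).
rewrite /index_iota -(big_map (fun j => ico_adj i j : nat) xpredT id) -sumnE.
apply/eqP; apply: (forall_ord (P := fun i =>
  sumn [seq (ico_adj i j : nat) | j <- iota 0 12] == 5%N)).
by vm_compute.
Qed.

Section IcosahedronDrawing.
Variable R : realType.

Definition real_point (x : int * int) : R * R := (x.1%:~R, x.2%:~R).

(** Moves the conditions on the drawing from the reals to the integers, where they are decided by
    computation. *)
Lemma orient_real_point (x y z : int * int) :
  orient (real_point x) (real_point y) (real_point z) = (orient x y z)%:~R.
Proof. by rewrite /orient /= !rmorphB !rmorphM !rmorphB. Qed.

Lemma open_side_real_point (x y z w : int * int) :
  open_side (real_point x) (real_point y) (real_point z) (real_point w) =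
  open_side x y z w.
Proof.
by rewrite /open_side !orient_real_point -rmorphD !ler0z !lerz0 ltr0z ltrz0.
Qed.

Lemma icosahedron_planar : planar R (edges_of icosahedron).
Proof.
apply: (straight_line_planar (p := fun i : 'I_12 => real_point (ico_point i))).
- exact: icosahedron_irr.
- move=> i j /eqP; rewrite /real_point xpair_eqE !eqr_int -xpair_eqE.
  rewrite -!surjective_pairing => E; apply/val_inj/eqP; move: E; apply/implyP.
  apply: (forall_ord2 (P := fun i j => (ico_point i == ico_point j) ==> (i == j))).
  by vm_compute.
- move=> a b v rab va vb; rewrite orient_real_point intr_eq0.
  have := forall_ord2 (n := 12) (P := fun a b => if ico_adj a b then
    all (fun v => [|| v == a, v == b |
      orient (ico_point a) (ico_point b) (ico_point v) != 0]) (iota 0 12)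
    else true) _ a b.
  rewrite -[ico_adj a b]/(icosahedron a b) rab => /(_ _)/(forall_ord (n := 12)).
  move=> /(_ _ v); rewrite -![nat_of_ord _ == nat_of_ord _]/(_ == _ :> 'I_12).
  by rewrite (negbTE va) (negbTE vb); apply; vm_compute.
- move=> a b c e rab rce ne; rewrite !open_side_real_point.
  have := forall_ord2 (n := 12) (P := fun a b => if ico_adj a b then
    all (fun c => all (fun e => if ico_adj c e then
      [|| (a == c) && (b == e), (a == e) && (b == c),
        open_side (ico_point a) (ico_point b) (ico_point c) (ico_point e) |
        open_side (ico_point c) (ico_point e) (ico_point a) (ico_point b)]
      else true) (iota 0 12)) (iota 0 12) else true) _ a b.
  rewrite -[ico_adj a b]/(icosahedron a b) rab => /(_ _)/(forall_ord2 (n := 12)).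
  move=> /(_ _ c e); rewrite -[ico_adj c e]/(icosahedron c e) rce.
  rewrite -![nat_of_ord _ == nat_of_ord _]/(_ == _ :> 'I_12).
  have -> : (a == c) && (b == e) = false.
    by apply: contraNF ne => /andP[/eqP-> /eqP->].
  have -> : (a == e) && (b == c) = false.
    by apply: contraNF ne => /andP[/eqP-> /eqP->]; rewrite finset.setUC.
  by apply; vm_compute.
Qed.

End IcosahedronDrawing.

(** * The extremal number: upper bound and the case n = 12 *)

Lemma ex_planar_S25_le (R : realType) (n : nat) : (1 <= n)%N ->
  (7 * ex_planar R n (double_star 2 5) + 18 <= 19 * n)%N.
Proof.
move=> n1; rewrite /ex_planar.
(* The initial value 0 of the maximum satisfies the bound because n >= 1. *)
elim/big_ind: _ => [|x y Hx Hy|E /and3P[sE /asboolP pE fE]].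
- lia.
- by rewrite /maxn; case: ifP.
have nostar : ~ has_double_star (adjacent E) 2 5.
  by move=> /double_star_subgraph H; move: fE; rewrite /subgraph_free H.
have S0 : [set: 'I_n]%SET != finset.set0.
  by rewrite -card_gt0 cardsT card_ord.
have := planar_star_free_edge_sum (@adjacent_sym _ E) (@adjacent_irr _ E) nostar
  (planar_drawable pE) S0.
rewrite edge_sum_adjacent // cardsT card_ord; lia.
Qed.

Lemma icosahedron_card : #|edges_of icosahedron| = 30%N.
Proof.
have := edge_sum_adjacent (simple_edges_of icosahedron_irr).
have -> : edge_sum (adjacent (edges_of icosahedron)) [set: 'I_12]%SET [set: 'I_12]%SET
    = (\sum_(i < 12) \sum_(j < 12) icosahedron i j)%N.
  apply: eq_big => [i|i _]; first by rewrite inE.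
  apply: eq_big => [j|j _]; first by rewrite inE.
  by rewrite adjacent_edges_of //; [apply: icosahedron_sym|apply: icosahedron_irr].
under eq_bigr do rewrite icosahedron_degree.
rewrite sum_nat_const card_ord; lia.
Qed.

(** A centre with five leaves has degree at least 6, whereas the icosahedron is 5-regular. *)
Lemma icosahedron_S25_free : subgraph_free (double_star 2 5) (edges_of icosahedron).
Proof.
apply/negP => /(double_star_degree (simple_edges_of icosahedron_irr))[v].
suff -> : #|[set w | adjacent (edges_of icosahedron) v w]%SET| = 5%N by [].
apply: etrans (icosahedron_degree v).
rewrite -sum1_card big_mkcond /=; apply: eq_bigr => j _.
rewrite inE adjacent_edges_of; [|exact: icosahedron_sym|exact: icosahedron_irr].
by case: (icosahedron v j).
Qed.

Theorem theorem1p1 (R : realType) (n : nat) (hn : (1 <= n)%N) :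
  (ex_planar R n (double_star 2 5))%:R <= 19 / 7 * n%:R - 18 / 7 :> rat
  /\ (n = 12%N ->
      (ex_planar R n (double_star 2 5))%:R = 19 / 7 * n%:R - 18 / 7 :> rat).
Proof.
have upper : (ex_planar R n (double_star 2 5))%:R <= 19 / 7 * n%:R - 18 / 7 :> rat.
  have := ex_planar_S25_le R hn.
  by rewrite -(ler_nat rat) natrD !natrM; lra.
split; first exact: upper.
move=> n12; apply: le_anti; rewrite upper n12 andTb.
(* The bound at n = 12 is (228 - 18)/7 = 30, the number of edges of the icosahedron. *)
have H : (30 <= ex_planar R 12 (double_star 2 5))%N.
  rewrite -icosahedron_card; apply: leq_bigmax_cond.
  rewrite simple_edges_of ?icosahedron_S25_free ?andbT /=; last exact: icosahedron_irr.
  exact/asboolP/icosahedron_planar.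
by move: H; rewrite -(ler_nat rat); lra.
Qed.
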